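(* Let $\mathcal{B}$ be a quasi-greedy basis of a quasi-Banach space $\mathbb{X}$. Then: (i) The restricted truncation operators $(\mathcal{U}_m)_{m=0}^\infty$ form a uniformly bounded family of operators. If $\mathbb{X}$ is a $p$-Banach space ($0<p\le1$), then $\Lambda_u\le C_{qg}^2\,\eta_p(C_{qg})$. (ii) For every $f\in\mathbb{X}$ we have $\lim_{m\to\infty}\mathcal{U}_m(f)=0$.
   Context: The scalar field is $\mathbb{R}$ or $\mathbb{C}$. A quasi-norm satisfies the axioms of a norm except that the triangle inequality is replaced by $\Vert f+g\Vert\le\kappa(\Vert f\Vert+\Vert g\Vert)$ for some constant $\kappa\ge1$; a quasi-Banach space is a vector space complete for the topology of a quasi-norm. It is a $p$-Banach space if moreover $\Vert f+g\Vert^p\le\Vert f\Vert^p+\Vert g\Vert^p$ for all $f,g$. A basis of $\mathbb{X}$ is a sequence $\mathcal{B}=(\mathbf{x}_n)_{n=1}^\infty$ whose closed linear span is $\mathbb{X}$ and for which there is a (unique) sequence $(\mathbf{x}_n^* )_{n=1}^\infty$ in $\mathbb{X}^*$ with $\mathbf{x}_n^*(\mathbf{x}_k)=\delta_{k,n}$. It is $M$-bounded if $\sup_n\Vert\mathbf{x}_n\Vert\,\Vert\mathbf{x}_n^*\Vert<\infty$ and semi-normalized if $0<\inf_n\Vert\mathbf{x}_n\Vert\le\sup_n\Vert\mathbf{x}_n\Vert<\infty$. The support of $f$ is $\mathrm{supp}(f)=\{n:\mathbf{x}_n^*(f)\ne0\}$. For finite $A\subseteq\mathbb{N}$, $S_A(f)=\sum_{n\in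 A}\mathbf{x}_n^*(f)\mathbf{x}_n$. A set $A\subseteq\mathbb{N}$ is a greedy set of $f$ if $|\mathbf{x}_k^*(f)|\le|\mathbf{x}_n^*(f)|$ for all $n\in A$, $k\in\mathbb{N}\setminus A$ (an infinite set $A$ is a greedy set of $f$ iff $\mathrm{supp}(f)\subseteq A$). For $m\ge0$, the $m$th greedy set $A_m(f)$ is the unique $A\subseteq\mathbb{N}$ with $|A|=m$ such that for all $n\in A$, $k\notin A$, either $|\mathbf{x}_n^*(f)|>|\mathbf{x}_k^*(f)|$, or equality holds and $n<k$. A quasi-greedy basis is an $M$-bounded semi-normalized basis for which there is $C<\infty$ with $\Vert S_A(f)\Vert\le C\Vert f\Vert$ for all $f$ and all finite greedy sets $A$ of $f$; $C_{qg}$ is then the smallest $C$ such that $\Vert S_{A\setminus B}(f)\Vert\le C\Vert f\Vert$ for all $f$ and all finite greedy sets $B\subseteq A$ of $f$. Let $\mathrm{sign}(0)=1$ and $\mathrm{sign}(a)=a/|a|$ for $a\ne0$. For $f\in\mathbb{X}$ and finite $A\subseteq\mathbb{N}$, $\mathcal{U}(f,A)=\min_{n\in A}|\mathbf{x}_n^*(f)|\sum_{n\in A}\mathrm{sign}(\mathbf{x}_n^*(f))\,\mathbf{x}_n$, with $\mathcal{U}(f,\emptyset)=0$, and $\mathcal{U}(f,A)=0$ if $A$ is infinite with $\mathrm{supp}(f)\subseteq A$. The $m$th restricted truncation operator is $\mathcal{U}_m(f)=\mathcal{U}(f,A_m(f))$. Uniformly bounded means $\sup_m\sup_{\Vert f\Vert\le1}\Vert\mathcal{U}_m(f)\Vert<\infty$.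 Further, $\Lambda_u=\sup\{\Vert\mathcal{U}(f,A)\Vert: A\text{ greedy set of }f,\ \Vert f\Vert\le1\}$. Finally $A_p=(2^p-1)^{-1/p}$ and $\eta_p(u)=\min_{0<t<1}(1-t^p)^{-1/p}\left(1-(1+A_p^{-1}u^{-1}t)^{-p}\right)^{-1/p}$ for $u>0$. *)

(* Defs.v *)
From HB Require Import structures.
From mathcomp Require Import all_boot all_order all_algebra.
From mathcomp Require Import complex.
From mathcomp Require Import all_classical all_reals all_analysis.

Set Implicit Arguments.
Unset Strict Implicit.
Unset Printing Implicit Defensive.

Import Order.TTheory GRing.Theory Num.Theory.
Import numFieldNormedType.Exports.

Local Open Scope classical_set_scope.
Local Open Scope card_scope.
Local Open Scope ring_scope.

Variant scalar_kind := RealScalars | ComplexScalars.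

Definition scalar_field (R : realType) (k : scalar_kind) : numFieldType :=
  match k with
  | RealScalars => R
  | ComplexScalars => R[i]
  end.

(* Absolute value with values in R: on a numFieldType K the library norm
   takes its values in K itself. *)
Definition modulus (R : realType) (k : scalar_kind) : scalar_field R k -> R :=
  match k with
  | RealScalars => fun a : R => `|a|
  | ComplexScalars => fun a : R[i] => complex.Re `|a|
  end.

Definition of_real (R : realType) (k : scalar_kind) : R -> scalar_field R k :=
  match k with
  | RealScalars => fun r : R => r
  | ComplexScalars => fun r : R => (r%:C)%C
  end.

Definition sign (R : realType) (k : scalar_kind) (a : scalar_field R k) :
    scalar_field R k :=
  if a == 0 then 1 else a / `|a|.

Section QuasiBanach.
Context (R : realType) (k : scalar_kind).
Context (X : PreUniformLmodule.type (scalar_field R k)).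
Implicit Types N : X -> R.

Record quasi_norm N : Prop := {
  quasi_norm_ge0 : forall f, 0 <= N f;
  quasi_norm_eq0 : forall f, N f = 0 -> f = 0;
  quasi_normZ : forall (a : scalar_field R k) f, N (a *: f) = modulus a * N f;
  quasi_normD : exists2 kappa : R, 1 <= kappa &
    forall f g, N (f + g) <= kappa * (N f + N g) }.

(* The second field says that the uniform structure of X, hence its topology,
   is the one given by N; PreUniformLmodule does not relate the uniformity to
   the vector space operations. *)
Record quasi_banach N : Prop := {
  quasi_banach_norm : quasi_norm N;
  quasi_banach_entourage :
    @entourage X = filter_from [set e : R | 0 < e]
                     (fun e => [set fg | N (fg.1 - fg.2) < e]);
  quasi_banach_complete :
    forall F : set_system X, ProperFilter F -> cauchy F ->
      exists f : X, F --> f }.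

Definition p_banach N (p : R) : Prop :=
  quasi_banach N /\
  forall f g, N (f + g) `^ p <= N f `^ p + N g `^ p.

Definition dual_norm N (phi : X -> scalar_field R k) : \bar R :=
  ereal_sup [set (modulus (phi f))%:E | f in [set f | N f <= 1]].

End QuasiBanach.

Section Bases.
Context (R : realType) (k : scalar_kind).
Context (X : PreUniformLmodule.type (scalar_field R k)) (N : X -> R).
Context (x : nat -> X) (xs : nat -> {scalar X}).

Definition lin_span : set X :=
  [set f | exists (n : nat) (c : nat -> scalar_field R k),
             f = \sum_(i < n) c i *: x i].

(* The functionals xs are determined by x, because they are continuous and the
   span of x is dense. *)
Record is_basis : Prop := {
  basis_dense : closure lin_span = [set: X];
  basis_continuous : forall n, continuous (xs n : X -> scalar_field R k);
  basis_biorthogonal : forall n j, xs n (x j) = (j == n)%:R }.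

Definition M_bounded : Prop :=
  (ereal_sup (range (fun n => (N (x n))%:E * dual_norm N (xs n))) < +oo)%E.

Definition semi_normalized : Prop :=
  (0 < ereal_inf (range (fun n => (N (x n))%:E)))%E /\
  (ereal_sup (range (fun n => (N (x n))%:E)) < +oo)%E.

Definition proj_set (A : set nat) (f : X) : X := \sum_(n \in A) xs n f *: x n.

Definition greedy_set (f : X) (A : set nat) : Prop :=
  forall n j, A n -> ~ A j -> modulus (xs j f) <= modulus (xs n f).

Definition quasi_greedy_basis : Prop :=
  [/\ is_basis, M_bounded, semi_normalized &
    exists C : R, forall (f : X) (A : set nat),
      finite_set A -> greedy_set f A -> N (proj_set A f) <= C * N f].

(* For a quasi-greedy basis the set below is nonempty, closed and bounded
   below, so that this infimum is its smallest element. *)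
Definition C_qg : R :=
  inf [set C : R | forall (f : X) (A B : set nat),
         finite_set A -> greedy_set f A -> greedy_set f B -> B `<=` A ->
         N (proj_set (A `\` B) f) <= C * N f].

Definition is_mth_greedy_set (f : X) (m : nat) (A : set nat) : Prop :=
  A #= `I_m /\
  forall n j, A n -> ~ A j ->
    modulus (xs j f) < modulus (xs n f) \/
    (modulus (xs n f) = modulus (xs j f) /\ (n < j)%N).

Definition mth_greedy_set (f : X) (m : nat) : set nat :=
  xget set0 (is_mth_greedy_set f m).

(* The infimum is a minimum when A is finite and nonempty; when A is empty the
   sum, hence the value, is 0. *)
Definition restricted_truncation_set (f : X) (A : set nat) : X :=
  if `[< finite_set A >] then
    of_real k (inf [set modulus (xs n f) | n in A]) *:
      \sum_(n \in A) sign (xs n f) *: x n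
  else 0.

Definition restricted_truncation (m : nat) (f : X) : X :=
  restricted_truncation_set f (mth_greedy_set f m).

Definition uniformly_bounded (T : nat -> X -> X) : Prop :=
  (ereal_sup (range (fun m =>
     ereal_sup [set (N (T m f))%:E | f in [set f | (N f <= 1)%R]])) < +oo)%E.

Definition Lambda_u : \bar R :=
  ereal_sup [set y | exists f A,
    [/\ greedy_set f A, N f <= 1 &
        y = (N (restricted_truncation_set f A))%:E]].

End Bases.

Definition A_const (R : realType) (p : R) : R := (2 `^ p - 1) `^ (- p^-1).

(* For 0 < p and 0 < u the expression is continuous in t and tends to +oo at
   both ends of ]0, 1[, so that the infimum is a minimum. *)
Definition eta_fun (R : realType) (p u : R) : R :=
  inf [set (1 - t `^ p) `^ (- p^-1) *
           (1 - (1 + (A_const p)^-1 * u^-1 * t) `^ (- p)) `^ (- p^-1)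
      | t in `]0, 1[%classic].

(* Main.v *)
(* By the Aoki-Rolewicz theorem we may work with a subadditive function M, comparable
   to a power N^p of the quasi-norm (N^p itself in a p-Banach space), with
   M(a f) = |a|^p M(f) and M(S_{A \ B} f) <= D M(f) for greedy sets B <= A.

   Let |a_n| denote the moduli of the coefficients of f, A a finite greedy set on
   which |a_n| >= s, and cut A into the slices (1 + d)^j s <= |a_n| < (1 + d)^(j+1) s.
   A slice S is a difference of greedy sets. On the lowest one, s times the sign sum
   1_S is the projection of f minus d s * (sum of b_n sign(a_n) x_n) with b_n in [0, 1].
   Binary expansion of the b_n bounds M of the latter sum by (2^p - 1)^-1 times the
   largest M(1_B) with B <= S, and M(1_B) <= D M(1_S) because B is a greedy set of 1_S.
   Choosing d so small that q = d^p D / (2^p - 1) < 1, the error is absorbed: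
   s^p M(1_S) <= (1 - q)^-1 D M(f). The bounds for the successive slices form a
   geometric series of ratio (1 + d)^-p. With D = C_qg^p and
   d = t / (A_p C_qg), so that q = t^p, this is Lambda_u <= C_qg eta_p(C_qg), which is
   at most C_qg^2 eta_p(C_qg).

   For the limit, f differs from an element of the span of x_0, ..., x_{n-1} by some g
   with M(g) small and all coefficients of g below n nonzero. The minimum of the
   coefficients on A_m(f) tends to 0, so for large m the set A_m(f) with {0, ..., n-1}
   adjoined is greedy for g, and the bound for g controls U_m(f) up to at most 2n
   terms whose common factor tends to 0. *)

Require Import Defs.
From HB Require Import structures.
From mathcomp Require Import all_boot all_order all_algebra.
From mathcomp Require Import complex ring lra.
From mathcomp Require Import all_classical all_reals all_analysis.
Import Order.TTheory GRing.Theory Num.Theory.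
Import numFieldNormedType.Exports.
Local Open Scope classical_set_scope.
Local Open Scope ring_scope.

(** * Scalars *)

Section Scalars.
Context {R : realType} {k : scalar_kind}.
Implicit Types a b : scalar_field R k.

Lemma modulus_ge0 a : 0 <= modulus a.
Proof. by case: k a => a /=; [exact: normr_ge0|case: a => u v /=; exact: sqrtr_ge0]. Qed.

Lemma modulusM a b : modulus (a * b) = modulus a * modulus b.
Proof.
case: k a b => a b /=; first exact: normrM.
have e (c : R[i]) : (complex.Re `|c|)%:C%C = `|c| by case: c.
by apply: (@complexI R); rewrite rmorphM /= !e normrM.
Qed.

Lemma modulus_eq0 a : modulus a = 0 -> a = 0.
Proof.
case: k a => a /=; first exact: normr0_eq0.
case: a => u v /= /eqP; rewrite sqrtr_eq0 => uv.
have : u ^+ 2 + v ^+ 2 == 0 by rewrite eq_le uv addr_ge0// sqr_ge0.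
by rewrite paddr_eq0 ?sqr_ge0// !sqrf_eq0 => /andP[/eqP-> /eqP->].
Qed.

Lemma modulus_of_real (r : R) : modulus (of_real k r) = `|r|.
Proof. by case: k => //=; rewrite expr0n addr0 sqrtr_sqr. Qed.

Lemma of_realB (r s : R) : of_real k (r - s) = of_real k r - of_real k s.
Proof. by case: k => //=; rewrite rmorphB. Qed.

Lemma of_realM (r s : R) : of_real k (r * s) = of_real k r * of_real k s.
Proof. by case: k => //=; rewrite rmorphM. Qed.

Lemma of_real1 : of_real k (1 : R) = 1.
Proof. by case: k. Qed.

Lemma of_real0 : of_real k (0 : R) = 0.
Proof. by case: k. Qed.

Lemma of_realD (r s : R) : of_real k (r + s) = of_real k r + of_real k s.
Proof. by case: k => //=; rewrite rmorphD. Qed.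

Lemma modulus1 : modulus (1 : scalar_field R k) = 1.
Proof. by rewrite -of_real1 modulus_of_real normr1. Qed.

Lemma modulus0 : modulus (0 : scalar_field R k) = 0.
Proof. by rewrite -of_real0 modulus_of_real normr0. Qed.

Lemma modulusN1 : modulus (-1 : scalar_field R k) = 1.
Proof. by rewrite -of_real1 -[- _]add0r -of_real0 -of_realB modulus_of_real sub0r normrN1. Qed.

Lemma of_real_modulus a : of_real k (modulus a) = `|a|.
Proof. by case: k a => a //=. Qed.

Lemma of_real_modulus_sign a : of_real k (modulus a) * sign a = a.
Proof.
rewrite of_real_modulus /sign; case: eqP => [->|/eqP a0]; first by rewrite normr0 mul0r.
by rewrite mulrC divfK// normr_eq0.
Qed.

(** The convention sign(0) = 1 makes this hold at 0 as well, so sign sums always have unimodular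
    coefficients. *)
Lemma modulus_sign a : modulus (sign a) = 1.
Proof.
rewrite /sign; case: eqP => [_|/eqP a0]; first exact: modulus1.
have n0 : modulus a != 0 by apply/eqP => /modulus_eq0 /eqP; rewrite (negbTE a0).
apply: (mulfI n0); rewrite mulr1 -[X in X * _]ger0_norm ?modulus_ge0//.
by rewrite -modulus_of_real -modulusM of_real_modulus mulrCA divff ?mulr1 ?normr_eq0.
Qed.

End Scalars.

(** * The Aoki-Rolewicz theorem *)

(** Such an [M] behaves like the p-th power of a p-norm. The format covers both the function built
    by Aoki-Rolewicz and [N ^ p] itself in a p-Banach space. *)
Record p_norm_power {R : realType} {k : scalar_kind} {X : lmodType (scalar_field R k)}
    (p : R) (M : X -> R) : Prop := {
  p_norm_power_ge0 : forall f, 0 <= M f;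
  p_norm_powerD : forall f g, M (f + g) <= M f + M g;
  p_norm_powerZ : forall (a : scalar_field R k) f, M (a *: f) = modulus a `^ p * M f }.

Arguments p_norm_power_ge0 {R k X p M}.
Arguments p_norm_powerD {R k X p M}.
Arguments p_norm_powerZ {R k X p M}.

Section AokiRolewicz.
Context {R : realType} {k : scalar_kind}
  {X : PreUniformLmodule.type (scalar_field R k)}.
Implicit Types (N M : X -> R) (f g h : X) (s : seq X).

(** The element [f] is the one at which the partial sums of [M] cross the level [a]; the induction
    lowers the level by the weight of the head. *)
Lemma seq_split_sum M s (a : R) : (forall f, 0 <= M f) ->
    s != [::] -> 0 <= a -> a <= \sum_(f <- s) M f ->
  exists s1 f s2, [/\ s = s1 ++ f :: s2, \sum_(g <- s1) M g <= a &
    a <= \sum_(g <- s1) M g + M f].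
Proof.
move=> M0; elim: s a => // f s IH a _ a0; rewrite big_cons => le_a.
have [afle|flt] := leP a (M f).
  by exists [::], f, s; split=> //; rewrite big_nil// add0r.
have s0 : s != [::].
  by apply: contraTneq le_a => ->; rewrite big_nil addr0 -ltNge.
have [||s1 [g [s2 [-> h1 h2]]]] := IH (a - M f) s0; try lra.
by exists (f :: s1), g, s2; split=> //; rewrite big_cons; lra.
Qed.

(* Cutting the chain at its half-weight point leaves two chains of at most half
   the weight around a single element. *)
Lemma chain_bound M s : (forall f, 0 <= M f) -> M 0 = 0 ->
    (forall f g h t, M f <= t -> M g <= t -> M h <= t -> M (f + g + h) <= 2 * t) ->
  M (\sum_(f <- s) f) <= 2 * \sum_(f <- s) M f.
Proof.
move=> M0 Mz M3; have [n] := ubnP (size s); elim: n s => // n IH s sn.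
have [->|s0] := eqVneq s [::]; first by rewrite !big_nil Mz mulr0.
have S0 : 0 <= \sum_(f <- s) M f by apply: sumr_ge0.
have [||s1 [g [s2 [es h1 h2]]]] := @seq_split_sum M s ((\sum_(f <- s) M f) / 2) M0 s0; try lra.
move: h1 h2 sn; rewrite es !big_cat !big_cons/= size_cat/= addnS ltnS => h1 h2 sn.
have L1 : 0 <= \sum_(f <- s1) M f by apply: sumr_ge0.
have L2 : 0 <= \sum_(f <- s2) M f by apply: sumr_ge0.
have IH1 := IH s1 (leq_ltn_trans (leq_addr _ _) sn).
have IH2 := IH s2 (leq_ltn_trans (leq_addl _ _) sn).
have Mg := M0 g.
by rewrite addrA; apply: M3; lra.
Qed.

(** [M f] is the infimum of the sums of [N ^ p] over all finite decompositions of [f]. Concatenating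
    decompositions gives subadditivity, and [chain_bound] gives the lower estimate. *)
Lemma aoki_rolewicz N : quasi_norm N ->
  exists (p : R) (M : X -> R), [/\ 0 < p, p_norm_power p M,
    forall f, M f <= N f `^ p & forall f, N f `^ p <= 2 * M f].
Proof.
move=> [N0 _ NZ [K K1 NK]].
(* Chosen so that (3 K^2)^p = 2: two uses of the quasi-triangle inequality cost at most 3 K^2 on a
   sum of three terms. *)
pose p : R := ln 2 / ln (3 * K ^+ 2).
have K3 : 1 < 3 * K ^+ 2 by nra.
have p0 : 0 < p by rewrite divr_gt0// ln_gt0// ltr1n.
pose Q f := N f `^ p.
have Q0 f : 0 <= Q f by exact: powR_ge0.
have QZ a f : Q (a *: f) = modulus a `^ p * Q f by rewrite /Q NZ powRM// modulus_ge0.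
have Q3 f g h t : Q f <= t -> Q g <= t -> Q h <= t -> Q (f + g + h) <= 2 * t.
  move=> ft gt ht; have t0 : 0 <= t := le_trans (Q0 f) ft.
  have inv g' : Q g' <= t -> N g' <= t `^ p^-1.
    move=> le_t; have := @ge0_ler_powR R p^-1 _ (Q g') t (Q0 g') t0 le_t.
    by rewrite /Q -powRrM divff ?gt_eqF// powRr1//; apply; rewrite invr_ge0 ltW.
  have -> : 2 * t = (3 * K ^+ 2 * t `^ p^-1) `^ p.
    rewrite powRM ?powR_ge0//; last by nra.
    rewrite -powRrM mulVf ?gt_eqF// powRr1//; congr (_ * _).
    rewrite /powR gt_eqF; last by nra.
    rewrite /p divfK ?gt_eqF ?ln_gt0// lnK//.
    by rewrite posrE ltr0n.
  apply: ge0_ler_powR; rewrite ?nnegrE; [exact: ltW|exact: N0| |].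
    by rewrite mulr_ge0 ?powR_ge0//; nra.
  have u0 : 0 <= t `^ p^-1 by exact: powR_ge0.
  move: (inv _ ft) (inv _ gt) (inv _ ht) u0; set u := t `^ p^-1 => fu gu hu u0.
  have fgu : N (f + g) <= K * (u + u).
    by apply: le_trans (NK _ _) _; rewrite ler_wpM2l ?lerD//; lra.
  apply: (@le_trans _ _ (K * (K * (u + u) + u))).
    by apply: le_trans (NK _ _) _; rewrite ler_wpM2l ?lerD//; lra.
  rewrite expr2 mulrCA -mulrA -mulrA ler_wpM2l//; [lra|nra].
have Qz : Q 0 = 0.
  by rewrite -(scale0r (0 : X)) QZ modulus0 powR0 ?mul0r ?gt_eqF.
pose chains f := [set s : seq X | \sum_(g <- s) g = f].
pose M f := inf [set \sum_(g <- s) Q g | s in chains f].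
have chain0 f : chains f [:: f] by rewrite /chains /= big_seq1.
have lb0 f : lbound [set \sum_(g <- s) Q g | s in chains f] 0.
  by move=> _ [s _ <-]; apply: sumr_ge0.
have Mle f s : chains f s -> M f <= \sum_(g <- s) Q g.
  by move=> cs; apply: ge_inf; [exists 0; exact: lb0|exists s].
have leM f t : (forall s, chains f s -> t <= \sum_(g <- s) Q g) -> t <= M f.
  move=> ht; apply: lb_le_inf; first by exists (\sum_(g <- [:: f]) Q g); exists [:: f].
  by move=> _ [s cs <-]; exact: ht.
have MQ f : M f <= Q f by have := Mle f _ (chain0 f); rewrite big_seq1.
have M0 f : 0 <= M f by apply: leM => s _; apply: sumr_ge0.
have MZle a f : M (a *: f) <= modulus a `^ p * M f.
  have [a0|a0] := eqVneq (modulus a) 0.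
    have -> : a = 0 by exact: modulus_eq0.
    by rewrite scale0r modulus0 powR0 ?gt_eqF// mul0r -Qz.
  have a1 : 0 < modulus a `^ p by rewrite powR_gt0// lt0r a0 modulus_ge0.
  rewrite -ler_pdivrMl//; apply: leM => s cs; rewrite ler_pdivrMl//.
  rewrite (_ : _ * _ = \sum_(g <- map (fun g => a *: g) s) Q g).
    by apply: Mle; rewrite /chains/= big_map -scaler_sumr cs.
  by rewrite big_map mulr_sumr; apply: eq_bigr => g _; rewrite QZ.
exists p, M; split=> //; first split=> //.
- move=> f g; rewrite -lerBlDr; apply: (leM) => s cs; rewrite lerBlDl -lerBlDr.
  apply: leM => s' cs'; rewrite lerBlDr -big_cat/=; apply: Mle.
  by rewrite /chains/= big_cat/= cs cs' addrC.
(* For nonzero [a] the reverse inequality is [MZle] for the scalar [a^-1] and the vector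
   [a *: f]. *)
- move=> a f; apply/eqP; rewrite eq_le MZle/=.
  have [a0|a0] := eqVneq (modulus a) 0; first by rewrite a0 powR0 ?gt_eqF// mul0r.
  have an0 : a != 0 by apply: contra_neq a0 => ->; exact: modulus0.
  have a1 : 0 < modulus a `^ p by rewrite powR_gt0// lt0r a0 modulus_ge0.
  rewrite -{1}(scale1r f) -(mulVf an0) -scalerA -ler_pdivlMl//.
  apply: (le_trans (MZle _ _)); rewrite le_eqVlt; apply/orP; left; apply/eqP.
  congr (_ * _); apply: (mulIf (lt0r_neq0 a1)); rewrite mulVf ?gt_eqF//.
  by rewrite -powRM ?modulus_ge0// -modulusM mulVf// modulus1 powR1.
- move=> f; rewrite -/(Q f) -ler_pdivrMl ?ltr0n//; apply: leM => s cs.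
  rewrite ler_pdivrMl ?ltr0n//; rewrite -{1}cs; exact: chain_bound.
Qed.

End AokiRolewicz.

Lemma expr_lt_eps {R : realType} (r e : R) : 0 <= r < 1 -> 0 < e ->
  exists n, r ^+ n < e.
Proof.
move=> /andP[r0 r1] e0; have nr : `|r| < 1 by rewrite ger0_norm.
have /cvgrPdist_lt /(_ _ e0) [n _ /(_ n (leqnn n))] := cvg_expr nr.
by rewrite /= sub0r normrN ger0_norm ?exprn_ge0//; exists n.
Qed.

(** * Finite sums *)

Section FiniteSums.
Context {R : realType} {k : scalar_kind}
  {X : PreUniformLmodule.type (scalar_field R k)}.

Lemma scaler_fsumr (A : set nat) (a : scalar_field R k) (F : nat -> X) : finite_set A ->
  a *: (\sum_(n \in A) F n) = \sum_(n \in A) a *: F n.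
Proof. by move=> fA; rewrite !fsbig_finite//= scaler_sumr. Qed.

Lemma ler_fsumr (A : set nat) (F G : nat -> R) : finite_set A ->
  (forall n, A n -> F n <= G n) -> \sum_(n \in A) F n <= \sum_(n \in A) G n.
Proof.
move=> fA FG; rewrite !fsbig_finite//= big_seq [leRHS]big_seq.
by apply: ler_sum => n; rewrite in_fset_set// inE => /FG.
Qed.

Lemma fsumrB (A : set nat) (F G : nat -> X) : finite_set A ->
  \sum_(n \in A) (F n - G n) = \sum_(n \in A) F n - \sum_(n \in A) G n.
Proof. by move=> fA; rewrite !fsbig_finite//= sumrB. Qed.

Lemma fsumr_restrict (A B : set nat) (y : nat -> X) : B `<=` A ->
  \sum_(n \in B) y n = \sum_(n \in A) of_real k (n \in B)%:R *: y n.
Proof.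
move=> BA; rewrite -{1}(setIidr BA) fsbig_mkcondr; apply: eq_fsbigr => n _.
by rewrite /patch; case: ifP => _; rewrite ?of_real1 ?of_real0 ?scale1r ?scale0r.
Qed.

Lemma coef_fsum (x : nat -> X) (xs : nat -> {scalar X}) (A : set nat)
    (c : nat -> scalar_field R k) (j : nat) :
    (forall n j, xs n (x j) = (j == n)%:R) -> finite_set A ->
  xs j (\sum_(n \in A) c n *: x n) = if j \in A then c j else 0.
Proof.
move=> bio fA; have [jA|jA] := boolP (j \in A).
  rewrite (fsbigD1 j)//=; last by rewrite inE in jA.
  rewrite linearD linearZ/= bio eqxx mulr1 fsbig_finite/=; last exact: finite_setD.
  rewrite linear_sum big1_seq ?addr0// => n /=.
  rewrite in_fset_set ?inE; last exact: finite_setD.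
  by move=> [_ /eqP nj]; rewrite linearZ/= bio (negbTE nj) mulr0.
rewrite fsbig_finite//= linear_sum big1_seq// => n /=.
rewrite in_fset_set// => nA; rewrite linearZ/= bio.
by case: eqP jA => [<-|]; rewrite ?nA ?mulr0.
Qed.

Context {p : R} {M : X -> R} (p0 : 0 < p) (hM : p_norm_power p M).

Lemma p_norm_power0 : M 0 = 0.
Proof.
by rewrite -(scale0r (0 : X)) (p_norm_powerZ hM) modulus0 powR0 ?mul0r ?gt_eqF.
Qed.

Lemma p_norm_powerN f : M (- f) = M f.
Proof. by rewrite -scaleN1r (p_norm_powerZ hM) modulusN1 powR1 mul1r. Qed.

Lemma p_norm_powerZr (r : R) f : 0 <= r -> M (of_real k r *: f) = r `^ p * M f.
Proof. by move=> r0; rewrite (p_norm_powerZ hM) modulus_of_real ger0_norm. Qed.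

Lemma p_norm_power_fsum (A : set nat) (F : nat -> X) : finite_set A ->
  M (\sum_(n \in A) F n) <= \sum_(n \in A) M (F n).
Proof.
move=> fA; rewrite !fsbig_finite//=; apply: (big_ind2 (fun u v => M u <= v)) => //.
  by rewrite p_norm_power0.
by move=> f u g v fu gv; apply: le_trans (p_norm_powerD hM _ _) (lerD fu gv).
Qed.

(* Writing b = (d + b') / 2 with d in {0, 1} and b' in [0, 1] peels off one
   binary digit of every coefficient at the price of a factor 2^-p. *)
Lemma binary_expansion_bound (A : set nat) (y : nat -> X) (S : R) (b : nat -> R) :
    finite_set A -> (forall B, B `<=` A -> M (\sum_(n \in B) y n) <= S) ->
    (forall n, A n -> 0 <= b n <= 1) ->
  M (\sum_(n \in A) of_real k (b n) *: y n) <= S / (2 `^ p - 1).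
Proof.
move=> fA hS; set T := \sum_(n \in A) M (y n).
have one_p : 1 `^ p = 1 :> R by rewrite powR1.
have two_p : 1 < 2 `^ p :> R.
  by rewrite -[X in X < _]one_p gt0_ltr_powR ?nnegrE ?ler01 ?ler0n ?ltr1n.
pose r : R := 2^-1 `^ p.
have rE : r = (2 `^ p)^-1.
  have e : r * 2 `^ p = 1 by rewrite -powRM ?invr_ge0 ?ler0n// mulVf ?powR1 ?pnatr_eq0.
  have n0 : 2 `^ p != 0 :> R by rewrite gt_eqF// (lt_trans ltr01).
  by apply: (mulIf n0); rewrite e mulVf.
have r01 : 0 <= r < 1 by rewrite powR_ge0 rE invf_lt1// (lt_trans ltr01).
have T0 : 0 <= T by apply: fsumr_ge0 => n _; exact: (p_norm_power_ge0 hM).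
(* After [J] digits the undigested remainder costs at most r^J T with r = 2^-p, while S / (2^p - 1)
   is the fixed point of u -> r (S + u). *)
have digits J : forall c : nat -> R, (forall n, A n -> 0 <= c n <= 1) ->
    M (\sum_(n \in A) of_real k (c n) *: y n) <= S / (2 `^ p - 1) + r ^+ J * T.
  elim: J => [|J IH] c c01.
    rewrite expr0 mul1r; apply: (@le_trans _ _ T); last first.
      rewrite ler_wpDl//; apply: divr_ge0; last by rewrite subr_ge0 ltW.
      exact: le_trans (p_norm_power_ge0 hM _) (hS set0 (@sub0set _ A)).
    apply: (le_trans (p_norm_power_fsum _ _ fA)).
    apply: ler_fsumr => // n nA.
    have /andP[c0 c1] := c01 n nA.
    rewrite p_norm_powerZr// ler_piMl ?(p_norm_power_ge0 hM)//.
    by rewrite -[leRHS]one_p; apply: ge0_ler_powR; rewrite ?nnegrE//; exact: ltW.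
  (* The indices whose leading binary digit is 1. *)
  pose B := A `&` [set n | 2^-1 <= c n].
  have BA : B `<=` A by move=> n [].
  pose c' n := 2 * c n - (n \in B)%:R.
  have c'01 n : A n -> 0 <= c' n <= 1.
    move=> nA; have /andP[c0 c1] := c01 n nA; rewrite /c'.
    have [|] := boolP (n \in B); first by rewrite inE => -[_ /=]; lra.
    move=> nB; have : c n < 2^-1.
      by rewrite ltNge; apply: contra nB => h; rewrite inE.
    by rewrite /=; lra.
  have -> : \sum_(n \in A) of_real k (c n) *: y n = of_real k 2^-1 *:
      (\sum_(n \in B) y n + \sum_(n \in A) of_real k (c' n) *: y n).
    rewrite (fsumr_restrict _ _ _ BA) -fsbig_split//= scaler_fsumr//.
    apply: eq_fsbigr => n _; rewrite -scalerDl -of_realD scalerA -of_realM.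
    by congr (of_real _ _ *: _); rewrite /c'; lra.
  rewrite p_norm_powerZr ?invr_ge0 ?ler0n// -/r.
  apply: (@le_trans _ _ (r * (S + (S / (2 `^ p - 1) + r ^+ J * T)))).
    apply: ler_wpM2l; first by case/andP: r01.
    by apply: le_trans (p_norm_powerD hM _ _) _; rewrite lerD ?hS ?IH.
  rewrite mulrDr mulrDr mulrA exprS addrA mulrA lerD2r le_eqVlt; apply/orP; left; apply/eqP.
  rewrite rE; field; apply/andP; split; last by rewrite gt_eqF// (lt_trans ltr01).
  by rewrite subr_eq0 gt_eqF.
move=> b01; apply/ler_addgt0Pr => e e0.
have [J hJ] := expr_lt_eps r (e / (T + 1)) r01 (divr_gt0 e0 (ltr_wpDl T0 ltr01)).
apply: (le_trans (digits J b b01)); rewrite lerD2l.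
move: hJ; rewrite ltr_pdivlMr ?ltr_wpDl// => /ltW; apply: le_trans.
by rewrite ler_wpM2l ?exprn_ge0 ?lerDl// powR_ge0.
Qed.

End FiniteSums.

(** * Truncation on a greedy set *)

(** An index lost by the cut has modulus below [s], and one outside [A] was already dominated. *)
Lemma greedy_set_ge {R : realType} {k : scalar_kind}
  {X : PreUniformLmodule.type (scalar_field R k)}
    (xs : nat -> {scalar X}) (f : X) (A : set nat) (s : R) : greedy_set xs f A ->
  greedy_set xs f (A `&` [set n | s <= modulus (xs n f)]).
Proof.
move=> gA n j [An /= sn] nAj; have [Aj|/gA] := pselect (A j); last exact.
by apply: le_trans sn; rewrite leNgt; apply/negP => /ltW sj; exact: nAj.
Qed.

Section TruncationBound.
Context {R : realType} {k : scalar_kind}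
  {X : PreUniformLmodule.type (scalar_field R k)}.
Context (x : nat -> X) (xs : nat -> {scalar X}).
Context (biorthogonal : forall n j, xs n (x j) = (j == n)%:R).
Context {p : R} {M : X -> R} (p0 : 0 < p) (hM : p_norm_power p M).
Context {D : R} (D0 : 0 <= D).
Context (quasi_greedy : forall (f : X) (A B : set nat), finite_set A ->
  greedy_set xs f A -> greedy_set xs f B -> B `<=` A ->
  M (proj_set x xs (A `\` B) f) <= D * M f).

Lemma greedy_set_set0 f : greedy_set xs f set0.
Proof. by []. Qed.

(* All nonzero coefficients of the larger sum have modulus 1, so every subset of
   its support is a greedy set of it. *)
Lemma sign_sum_subset (f : X) (A B : set nat) : finite_set A -> B `<=` A ->
  M (\sum_(n \in B) sign (xs n f) *: x n) <=
  D * M (\sum_(n \in A) sign (xs n f) *: x n).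
Proof.
move=> fA BA; set g := \sum_(n \in A) sign (xs n f) *: x n.
have gE j : xs j g = if j \in A then sign (xs j f) else 0 by exact: coef_fsum.
have gB : greedy_set xs g B.
  move=> n j /BA An _; rewrite !gE (mem_set An) modulus_sign.
  by case: ifP => _; rewrite ?modulus_sign ?modulus0.
have := quasi_greedy g B set0 (sub_finite_set BA fA) gB (greedy_set_set0 g) (@sub0set _ _).
rewrite setD0 /proj_set; congr (M _ <= _).
by apply: eq_fsbigr => n; rewrite inE => /BA An; rewrite gE (mem_set An).
Qed.

Context {d : R} (d0 : 0 < d).
Let q := d `^ p * (D / (2 `^ p - 1)).
Context (q1 : q < 1).

(** The moduli on the slice are s + d s b_n with 0 <= b_n <= 1. The error term is at most [q] times
    the left-hand side itself, so it is absorbed when dividing by 1 - q. *)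
Lemma slice_bound (f : X) (A B : set nat) (s : R) : finite_set A ->
    greedy_set xs f A -> greedy_set xs f B -> B `<=` A -> 0 < s ->
    (forall n, A n -> ~ B n -> s <= modulus (xs n f) <= (1 + d) * s) ->
  M (of_real k s *: \sum_(n \in A `\` B) sign (xs n f) *: x n) <= (1 - q)^-1 * (D * M f).
Proof.
move=> fA gA gB BA s0 sP; set A' := A `\` B.
have fA' : finite_set A' by exact: finite_setD.
set e := \sum_(n \in A') sign (xs n f) *: x n.
pose b n := (modulus (xs n f) - s) / (d * s).
have ds0 : 0 < d * s by exact: mulr_gt0.
have b01 n : A' n -> 0 <= b n <= 1.
  move=> [An Bn]; have /andP[h1 h2] := sP n An Bn.
  by apply/andP; split; [apply: divr_ge0; [lra|exact: ltW]|rewrite ler_pdivrMr// mul1r; lra].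
pose w := \sum_(n \in A') of_real k (b n) *: (sign (xs n f) *: x n).
have Mw : M w <= D * M e / (2 `^ p - 1).
  by apply: (binary_expansion_bound p0 hM) => // B' B'A; exact: sign_sum_subset.
have eE : of_real k s *: e = proj_set x xs A' f - of_real k (d * s) *: w.
  rewrite /proj_set !scaler_fsumr// -fsumrB//; apply: eq_fsbigr => n _.
  rewrite !scalerA -scalerBl; congr (_ *: _).
  rewrite -{2}(of_real_modulus_sign (xs n f)) -of_realM -mulrBl -of_realB.
  by congr (of_real _ _ * _); rewrite /b mulrC divfK ?gt_eqF//; lra.
rewrite ler_pdivlMl ?subr_gt0// mulrBl mul1r lerBlDr.
rewrite {1}eE; apply: le_trans (p_norm_powerD hM _ _) _.
rewrite (p_norm_powerN hM); apply: lerD; first exact: quasi_greedy.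
rewrite !(p_norm_powerZr hM) ?(ltW s0) ?(ltW ds0)// powRM ?(ltW s0) ?(ltW d0)// /q.
have := ler_wpM2l (mulr_ge0 (powR_ge0 d p) (powR_ge0 s p)) Mw.
by move=> h; apply: le_trans h _; rewrite le_eqVlt; apply/orP; left; apply/eqP; ring.
Qed.

(** Raising the threshold by the factor 1 + d costs one slice, at most [E], and multiplies the bound
    for the rest by r = (1 + d)^-p. The value E / (1 - r) is the fixed point of u -> r u + E. *)
Lemma truncation_bound (f : X) (A : set nat) (s : R) : finite_set A ->
    greedy_set xs f A -> 0 <= s -> (forall n, A n -> s <= modulus (xs n f)) ->
  M (of_real k s *: \sum_(n \in A) sign (xs n f) *: x n) <=
    (1 - (1 + d) `^ (- p))^-1 * ((1 - q)^-1 * (D * M f)).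
Proof.
move=> fA gA s_ge0 sP; set r := (1 + d) `^ (- p); set E := (1 - q)^-1 * (D * M f).
have E0 : 0 <= E.
  by rewrite mulr_ge0 ?invr_ge0 ?subr_ge0 ?(ltW q1)// mulr_ge0 ?(p_norm_power_ge0 hM).
have d1 : 1 < 1 + d by rewrite ltrDl.
have d2 : 0 < 1 + d by exact: lt_trans d1.
have rd : r * (1 + d) `^ p = 1.
  by rewrite /r -powRD ?addNr ?powRr0//; apply/implyP => _; rewrite gt_eqF.
have r1 : r < 1.
  have dp : 1 < (1 + d) `^ p.
    by have := @gt0_ltr_powR R p p0 1 (1 + d); rewrite powR1; apply; rewrite ?nnegrE ?(ltW d2).
  by rewrite -[ltRHS]rd ltr_pMr// powR_gt0.
have L0 : 0 <= (1 - r)^-1 by rewrite invr_ge0 subr_ge0 ltW.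
move: s_ge0; rewrite le_eqVlt => /predU1P[<-|s0].
  by rewrite of_real0 scale0r (p_norm_power0 p0 hM) mulr_ge0.
(* Induction on the number [K] of slices above the threshold [t]; for K = 0 no modulus fits and [B]
   is empty. *)
have slices K : forall B t, B `<=` A -> greedy_set xs f B -> 0 < t ->
    (forall n, B n -> t <= modulus (xs n f) < (1 + d) ^+ K * t) ->
    M (of_real k t *: \sum_(n \in B) sign (xs n f) *: x n) <= (1 - r)^-1 * E.
  elim: K => [|K IH] B t BA gB t0 tP.
    have -> : B = set0.
      rewrite -subset0 => n /tP; rewrite expr0 mul1r => /andP[h1 h2].
      by have := le_lt_trans h1 h2; rewrite ltxx.
    by rewrite fsbig_set0 scaler0 (p_norm_power0 p0 hM) mulr_ge0.
  have fB := sub_finite_set BA fA.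
  (* [C] is what lies above the lowest slice, and is handled by induction at the threshold (1 + d)
     t. *)
  pose C := B `&` [set n | (1 + d) * t <= modulus (xs n f)].
  have CB : C `<=` B by move=> n [].
  have gC : greedy_set xs f C by exact: greedy_set_ge.
  have u0 : 0 < (1 + d) * t by rewrite mulr_gt0.
  have hC : M (of_real k ((1 + d) * t) *: \sum_(n \in C) sign (xs n f) *: x n) <=
      (1 - r)^-1 * E.
    apply: IH => // [n /CB /BA //|n [/tP /andP[_ h] /= ->]].
    by rewrite mulrA -exprSr.
  have hS : M (of_real k t *: \sum_(n \in B `\` C) sign (xs n f) *: x n) <= E.
    apply: slice_bound => // n Bn Cn; have /andP[-> _] := tP n Bn.
    by rewrite /= leNgt; apply/negP => /ltW h; apply: Cn.
  rewrite (fsbigID C)//= (setIidr CB) scalerDr -/(setD B C).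
  apply: le_trans (p_norm_powerD hM _ _) _.
  have -> : (1 - r)^-1 * E = r * ((1 - r)^-1 * E) + E by field; rewrite subr_eq0 gt_eqF.
  apply: lerD hS.
  have -> : of_real k t = of_real k ((1 + d)^-1) * of_real k ((1 + d) * t).
    by rewrite -of_realM mulKf// gt_eqF.
  rewrite -scalerA (p_norm_powerZr hM) ?invr_ge0 ?(ltW d2)//.
  have -> : (1 + d)^-1 `^ p = r.
    by rewrite -powR_inv1 ?(ltW d2)// -powRrM mulN1r.
  by rewrite ler_wpM2l ?powR_ge0.
(* A crude upper bound for the moduli on the finite set [A]; it shows that finitely many slices
   suffice. *)
set b := \sum_(n \in A) modulus (xs n f).
have bP n : A n -> modulus (xs n f) <= b.
  move=> An; rewrite /b (fsbigD1 n)//= lerDl.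
  by apply: fsumr_ge0 => j _; exact: modulus_ge0.
have b0 : 0 <= b by apply: fsumr_ge0 => j _; exact: modulus_ge0.
have i01 : 0 <= (1 + d)^-1 < 1 by rewrite invr_ge0 (ltW d2) invf_lt1.
have [K hK] := expr_lt_eps _ (s / (b + 1)) i01 (divr_gt0 s0 (ltr_wpDl b0 ltr01)).
apply: (slices K) => // n An; rewrite sP//=; apply: le_lt_trans (bP n An) _.
move: hK; rewrite exprVn ltr_pdivlMr ?ltr_wpDl// mulrC ltr_pdivrMr ?exprn_gt0//.
by rewrite mulrC; apply: lt_trans; rewrite ltrDl.
Qed.

End TruncationBound.

Lemma powR_ler_cancel {R : realType} (p a b : R) : 0 < p -> 0 <= a -> 0 <= b ->
  a `^ p <= b `^ p -> a <= b.
Proof.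
move=> p0 a0 b0; rewrite !leNgt; apply: contra => ba.
by apply: gt0_ltr_powR; rewrite ?nnegrE.
Qed.

Lemma powR_ltr_cancel {R : realType} (p a b : R) : 0 < p -> 0 <= a -> 0 <= b ->
  a `^ p < b `^ p -> a < b.
Proof.
move=> p0 a0 b0; rewrite !ltNge; apply: contra => ba.
by apply: ge0_ler_powR; rewrite ?nnegrE// ltW.
Qed.

Lemma powR_invK {R : realType} (p a : R) : 0 < p -> 0 <= a -> (a `^ p^-1) `^ p = a.
Proof. by move=> p0 a0; rewrite -powRrM mulVf ?gt_eqF// powRr1. Qed.

(** * Constants of a quasi-greedy basis *)

Section QuasiGreedy.
Context {R : realType} {k : scalar_kind}
  {X : PreUniformLmodule.type (scalar_field R k)}.
Context {N : X -> R} {x : nat -> X} {xs : nat -> {scalar X}}.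
Context (hN : quasi_norm N) (hB : quasi_greedy_basis N x xs).

Let bio : forall n j, xs n (x j) = (j == n)%:R.
Proof. by case: hB => -[]. Qed.

(** The infimum defining [C_qg] is over a nonempty set and is itself admissible, since each
    inequality passes to the infimum after division by [N f]. *)
Lemma C_qg_spec : 1 <= C_qg N x xs /\
  forall (f : X) (A B : set nat), finite_set A -> greedy_set xs f A ->
    greedy_set xs f B -> B `<=` A -> N (proj_set x xs (A `\` B) f) <= C_qg N x xs * N f.
Proof.
case: hN => N0 Neq0 NZ [K K1 NK]; have [_ _ _ [C qg]] := hB.
have NN f : N (- f) = N f by rewrite -scaleN1r NZ modulusN1 mul1r.
have ne : [set C : R | forall (f : X) (A B : set nat),
         finite_set A -> greedy_set xs f A -> greedy_set xs f B -> B `<=` A ->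
         N (proj_set x xs (A `\` B) f) <= C * N f] !=set0.
  (* The projection on A \ B is a difference of two greedy projections, each bounded by C N(f). *)
  exists (K * (C + C)) => f A B fA gA gB BA.
  have fB := sub_finite_set BA fA.
  have -> : proj_set x xs (A `\` B) f = proj_set x xs A f - proj_set x xs B f.
    by rewrite /proj_set (fsbigID B A)//= (setIidr BA) addrAC subrr add0r.
  apply: le_trans (NK _ _) _; rewrite NN -mulrA ler_wpM2l ?(le_trans ler01)//.
  by rewrite mulrDl lerD ?qg.
have xs0x : xs 0%N (x 0%N) = 1 by rewrite bio eqxx.
have Nx : 0 < N (x 0%N).
  rewrite lt0r N0 andbT; apply/eqP => /Neq0 x0.
  by move: xs0x; rewrite x0 linear0 => /eqP; rewrite eq_sym oner_eq0.
split.
  (* Testing on the first basis vector, which its greedy set {0} reproduces, forces every admissible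
     constant to be at least 1. *)
  apply: lb_le_inf => // c /(_ (x 0%N) [set 0%N] set0 (finite_set1 _)) h.
  rewrite -(ler_pM2r Nx) mul1r; apply: le_trans (h _ _ _); first last.
  - exact: sub0set.
  - by [].
  - move=> n j -> /= j0; rewrite !bio eqxx modulus1.
    by case: eqP => [/esym//|_]; rewrite modulus0.
  - by rewrite setD0 /proj_set fsbig_set1 xs0x scale1r.
move=> f A B fA gA gB BA; have [f0|f0] := eqVneq (N f) 0.
  by have [c /(_ f A B fA gA gB BA)] := ne; rewrite f0 !mulr0.
have Nf : 0 < N f by rewrite lt0r f0 N0.
rewrite -ler_pdivrMr//; apply: lb_le_inf => // c /(_ f A B fA gA gB BA).
by rewrite ler_pdivrMr.
Qed.

(** M-boundedness controls N(x_n) times the dual norm of the n-th functional; the positive lower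
    bound on N(x_n) then makes the functionals uniformly bounded. *)
Lemma coef_bound : exists2 K : R, 0 <= K & forall n f, modulus (xs n f) <= K * N f.
Proof.
case: hN => N0 Neq0 NZ _; have [_ Mb [infx _] _] := hB.
have [r hr] : exists r : R, forall n f, N f <= 1 -> N (x n) * modulus (xs n f) <= r.
  have h n f : N f <= 1 -> ((N (x n) * modulus (xs n f))%:E <=
      ereal_sup (range (fun n => (N (x n))%:E * dual_norm N (xs n))))%E.
    move=> f1; apply: le_trans (ereal_sup_ubound _); last by exists n.
    rewrite EFinM; apply: lee_wpmul2l; first by rewrite lee_fin.
    by apply: ereal_sup_ubound; exists f.
  move: Mb h; rewrite /M_bounded; case: ereal_sup => [r|//|] _ h.
    by exists r => n f /(h n f); rewrite lee_fin.
  by exists 0 => n f /(h n f).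
have [c c0 hc] : exists2 c : R, 0 < c & forall n, c <= N (x n).
  have h n : (ereal_inf (range (fun n => (N (x n))%:E)) <= (N (x n))%:E)%E.
    by apply: ereal_inf_lbound; exists n.
  move: infx h; case: ereal_inf => [c|_|//].
    by rewrite lte_fin => c0 h; exists c => // n; rewrite -lee_fin.
  by move=> h; exists 1 => // n; have := h n.
have r0 : 0 <= r.
  apply: le_trans (hr 0%N 0 _); first by rewrite mulr_ge0 ?modulus_ge0.
  by rewrite -(scale0r (0 : X)) NZ modulus0 mul0r.
exists (r / c); first by rewrite divr_ge0// ltW.
move=> n f; have [/Neq0 ->|f0] := eqVneq (N f) 0.
  by rewrite linear0 modulus0 mulr_ge0 ?divr_ge0 ?N0 ?(ltW c0).
have Nf : 0 < N f by rewrite lt0r f0 N0.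
have Ni : 0 <= (N f)^-1 by rewrite invr_ge0.
have := hr n (of_real k (N f)^-1 *: f); rewrite NZ modulus_of_real ger0_norm// mulVf//.
move=> /(_ (lexx _)); rewrite linearZ/= modulusM modulus_of_real ger0_norm// => h.
rewrite -ler_pdivrMr// ler_pdivlMr// mulrC; apply: le_trans h.
rewrite [modulus _ / _]mulrC ler_wpM2r ?mulr_ge0 ?modulus_ge0//.
Qed.

(** The qualitative bound for an arbitrary quasi-norm, obtained by running the slicing argument on
    the Aoki-Rolewicz function. *)
Lemma exists_truncation_bound : exists (p : R) (M : X -> R) (L : R),
  [/\ 0 < p /\ 0 <= L, p_norm_power p M, forall f, M f <= N f `^ p,
      forall f, N f `^ p <= 2 * M f &
      forall f A (s : R), finite_set A -> greedy_set xs f A -> 0 <= s ->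
        (forall n, A n -> s <= modulus (xs n f)) ->
        M (of_real k s *: \sum_(n \in A) sign (xs n f) *: x n) <= L * M f].
Proof.
have [p [M [p0 hM MN NM]]] := aoki_rolewicz _ hN.
have [C1 hC] := C_qg_spec.
(* The factor 2 is the price of passing from [N ^ p] back to [M]. *)
set C := C_qg N x xs in C1 hC; pose D := 2 * C `^ p.
have C0 : 0 <= C := le_trans ler01 C1.
have D0 : 0 <= D by rewrite mulr_ge0 ?powR_ge0.
have hD f A B : finite_set A -> greedy_set xs f A -> greedy_set xs f B -> B `<=` A ->
    M (proj_set x xs (A `\` B) f) <= D * M f.
  move=> fA gA gB BA; apply: le_trans (MN _) _.
  have N0 := quasi_norm_ge0 hN.
  apply: (@le_trans _ _ ((C * N f) `^ p)).
    by apply: ge0_ler_powR; rewrite ?nnegrE ?mulr_ge0// ?hC// ltW.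
  by rewrite powRM// /D -mulrA mulrCA ler_wpM2l ?powR_ge0 ?NM.
have two_p : 0 < 2 `^ p - 1 :> R.
  have := @gt0_ltr_powR R p p0 1 2; rewrite powR1 subr_gt0; apply.
  - by rewrite nnegrE.
  - by rewrite nnegrE.
  - by rewrite ltr1n.
have E0 : 0 <= D / (2 `^ p - 1) by rewrite divr_ge0// ltW.
(* With d^p = 1 / (E + 1) the absorbed fraction is E / (E + 1) < 1. *)
set E := D / (2 `^ p - 1) in E0; pose d : R := ((E + 1)^-1) `^ p^-1.
have E1 : 0 < E + 1 by rewrite ltr_wpDl.
have d0 : 0 < d by rewrite powR_gt0// invr_gt0.
have q1 : d `^ p * E < 1.
  by rewrite powR_invK ?invr_ge0 ?(ltW E1)// mulrC ltr_pdivrMr// mul1r ltrDl.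
exists p, M, ((1 - (1 + d) `^ (- p))^-1 * ((1 - d `^ p * E)^-1 * D)); split=> //.
  split=> //; rewrite mulr_ge0 ?mulr_ge0 ?invr_ge0 ?subr_ge0 ?(ltW q1) ?powR_ge0//.
  rewrite powRN invf_le1 ?powR_gt0 ?ltr_wpDl//.
  by rewrite -[leLHS](powRr0 (1 + d)) ler_powR ?lerDl ?ltW.
move=> f A s fA gA s0 sP; rewrite -mulrA -[X in _ * X]mulrA.
exact: (truncation_bound _ _ bio p0 hM D0 hD d0 q1).
Qed.

End QuasiGreedy.

(** * Restricted truncations and m-th greedy sets *)

Section RestrictedTruncation.
Context {R : realType} {k : scalar_kind}
  {X : PreUniformLmodule.type (scalar_field R k)}.
Context {x : nat -> X} {xs : nat -> {scalar X}}.

Lemma has_lbound_moduli (f : X) (A : set nat) :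
  has_lbound [set modulus (xs n f) | n in A].
Proof. by exists 0 => _ [n _ <-]; exact: modulus_ge0. Qed.

Lemma inf_moduli_ge0 (f : X) (A : set nat) : 0 <= inf [set modulus (xs n f) | n in A].
Proof.
have [->|/set0P[n An]] := eqVneq A set0; first by rewrite image_set0 inf0.
apply: lb_le_inf; first by exists (modulus (xs n f)); exists n.
by move=> _ [j _ <-]; exact: modulus_ge0.
Qed.

Lemma inf_moduli_le (f : X) (A : set nat) (n : nat) : A n ->
  inf [set modulus (xs n f) | n in A] <= modulus (xs n f).
Proof. by move=> An; apply: ge_inf; [exact: has_lbound_moduli|exists n]. Qed.

(** Replaces the infimum by an arbitrary nonnegative lower bound [s] of the moduli; the premise
    [P 0] covers infinite [A]. *)
Lemma restricted_truncation_set_ind (P : X -> Prop) (f : X) (A : set nat) :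
    P 0 -> greedy_set xs f A ->
    (forall s, finite_set A -> 0 <= s -> (forall n, A n -> s <= modulus (xs n f)) ->
      P (of_real k s *: \sum_(n \in A) sign (xs n f) *: x n)) ->
  P (restricted_truncation_set x xs f A).
Proof.
move=> P0 gA hP; rewrite /restricted_truncation_set; case: asboolP => // fA.
by apply: hP => //; [exact: inf_moduli_ge0|move=> n; exact: inf_moduli_le].
Qed.

(** The empty set is the default of [xget]; since it is trivially greedy, both cases can be treated
    without constructing the m-th greedy set. *)
Lemma mth_greedy_set_cases (f : X) (m : nat) :
  mth_greedy_set xs f m = set0 \/ is_mth_greedy_set xs f m (mth_greedy_set xs f m).
Proof. by rewrite /mth_greedy_set; case: xgetP; [move=> A _ ? |]; [right|left]. Qed.

Lemma is_mth_greedy_set_greedy (f : X) (m : nat) (A : set nat) :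
  is_mth_greedy_set xs f m A -> finite_set A /\ greedy_set xs f A.
Proof.
move=> [cA hA]; split; first by apply/finite_setP; exists m.
by move=> n j An nAj; have [/ltW//|[-> _]] := hA n j An nAj.
Qed.

Lemma mth_greedy_set_greedy (f : X) (m : nat) : greedy_set xs f (mth_greedy_set xs f m).
Proof. by have [->//|/is_mth_greedy_set_greedy[]] := mth_greedy_set_cases f m. Qed.

End RestrictedTruncation.

Lemma finite_lower_bound {R : realType} (v : nat -> R) (n : nat) :
  (forall i, (i < n)%N -> 0 < v i) -> exists2 e : R, 0 < e & forall i, (i < n)%N -> e <= v i.
Proof.
elim: n => [|n IH] v0; first by exists 1.
have [i lt_in|e e0 he] := IH; first by apply: v0; exact: ltnW.
exists (Num.min e (v n)); first by rewrite lt_min e0 v0.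
move=> i; rewrite ltnS leq_eqVlt => /predU1P[->|/he ie]; rewrite ge_min ?lexx ?orbT//.
by rewrite ie.
Qed.

(** * Pointwise convergence to zero *)

Section Vanishing.
Context {R : realType} {k : scalar_kind}
  {X : PreUniformLmodule.type (scalar_field R k)}.
Context {N : X -> R} {x : nat -> X} {xs : nat -> {scalar X}}.
Context (hX : quasi_banach N) (hB : quasi_greedy_basis N x xs).

Let hN : quasi_norm N := quasi_banach_norm hX.

Let bio : forall n j, xs n (x j) = (j == n)%:R.
Proof. by case: hB => -[]. Qed.

Lemma coef_finite_sum (n : nat) (c : nat -> scalar_field R k) (j : nat) :
  xs j (\sum_(i < n) c i *: x i) = if (j < n)%N then c j else 0.
Proof.
rewrite (fsbig_ord _ _ (fun i => c i *: x i)) (coef_fsum _ _ _ _ _ bio) ?finite_II//.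
by congr (if _ then _ else _); apply/idP/idP; rewrite inE.
Qed.

Lemma span_approx (f : X) (e : R) : 0 < e ->
  exists (n : nat) (c : nat -> scalar_field R k), N (f - \sum_(i < n) c i *: x i) < e.
Proof.
move=> e0; have [[dense _ _] _ _ _] := hB.
have : closure (lin_span x) f by rewrite dense.
have ent : entourage [set fg : X * X | N (fg.1 - fg.2) < e].
  by rewrite (quasi_banach_entourage hX); exists e.
move=> /(_ _ (nbhs_entourage f ent)) [g [[n [c ->]]]].
by rewrite /xsection/= inE/= => h; exists n, c.
Qed.

(** More than [n] indices cannot all lie below [n], and from [n] on the coefficients of [f] are
    those of its difference with a nearby element of the span of the first [n] vectors, hence small
    by [coef_bound]. *)
Lemma inf_mth_greedy_set_small (f : X) (e : R) : 0 < e ->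
  exists m0, forall m A, (m0 <= m)%N -> is_mth_greedy_set xs f m A ->
    exists2 n, A n & modulus (xs n f) <= e.
Proof.
move=> e0; have [K K0 hK] := coef_bound hN hB.
have K1 : 0 < K + 1 by rewrite ltr_wpDl.
have [n [c hc]] := span_approx f (e / (K + 1)) (divr_gt0 e0 K1).
exists n.+1 => m A nm [cA _].
have [j Aj nj] : exists2 j, A j & (n <= j)%N.
  apply: contrapT => no; suff : (`I_m #<= `I_n)%card by rewrite card_le_II leqNgt nm.
  rewrite -(card_le_eql cA); apply: subset_card_le => j Aj /=.
  by rewrite ltnNge; apply/negP => nj; apply: no; exists j.
exists j => //.
have -> : xs j f = xs j (f - \sum_(i < n) c i *: x i).
  by rewrite linearB/= coef_finite_sum ltnNge nj/= subr0.
apply: le_trans (hK _ _) _; move: hc; rewrite ltr_pdivlMr// => /ltW; apply: le_trans.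
by rewrite mulrC ler_wpM2l ?lerDl// (quasi_norm_ge0 hN).
Qed.

Context {p : R} {M : X -> R} {L : R} (p0 : 0 < p) (L0 : 0 <= L) (hM : p_norm_power p M).
Context (MN : forall f, M f <= N f `^ p) (NM : forall f, N f `^ p <= 2 * M f).
Context (hL : forall f A (s : R), finite_set A -> greedy_set xs f A -> 0 <= s ->
        (forall n, A n -> s <= modulus (xs n f)) ->
        M (of_real k s *: \sum_(n \in A) sign (xs n f) *: x n) <= L * M f).

Lemma small_powR_mul (c e : R) : 0 <= c -> 0 < e -> exists2 d : R, 0 < d & d `^ p * c < e.
Proof.
move=> c0 e0; have c1 : 0 < c + 1 by rewrite ltr_wpDl.
exists ((e / (c + 1)) `^ p^-1); first by rewrite powR_gt0// divr_gt0.
rewrite powR_invK// ?(ltW (divr_gt0 e0 c1))// mulrAC ltr_pdivrMr//.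
by rewrite ltr_pM2l// ltrDl.
Qed.

(* The coefficients below n are made nonzero so that they dominate every
   sufficiently small threshold. *)
Lemma small_remainder (f : X) (e : R) : 0 < e ->
  exists (g : X) (n : nat), [/\ M g < e, forall j, (n <= j)%N -> xs j g = xs j f &
    forall j, (j < n)%N -> 0 < modulus (xs j g)].
Proof.
move=> e0; have e2 : 0 < e / 2 by rewrite divr_gt0.
have M0 := p_norm_power_ge0 hM.
have [n [c hc]] := span_approx f ((e / 2) `^ p^-1) (powR_gt0 _ e2).
set h := f - _ in hc.
have Mh : M h < e / 2.
  apply: le_lt_trans (MN h) _; rewrite -[ltRHS](powR_invK p)// ?(ltW e2)//.
  by apply: gt0_ltr_powR; rewrite ?nnegrE// ?(quasi_norm_ge0 hN) ?powR_ge0.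
(* Subtracting d z turns exactly the vanishing coefficients below [n] into -d and leaves the others
   unchanged. *)
pose b j : scalar_field R k := (xs j h == 0)%:R.
pose z := \sum_(i < n) b i *: x i.
have [d d0 dz] := small_powR_mul (M z) (e / 2) (M0 z) e2.
exists (h - of_real k d *: z), n; split=> [|j nj|j jn].
- apply: le_lt_trans (p_norm_powerD hM _ _) _.
  by rewrite (p_norm_powerN hM) (p_norm_powerZr hM) ?(ltW d0)//; lra.
- rewrite linearB linearZ/= coef_finite_sum ltnNge nj/= mulr0 subr0.
  by rewrite /h linearB/= coef_finite_sum ltnNge nj/= subr0.
- rewrite lt0r modulus_ge0 andbT; apply/eqP => /modulus_eq0.
  rewrite linearB linearZ/= coef_finite_sum jn /b; case: eqP => [->|h0].
    rewrite mulr1 sub0r => /eqP; rewrite oppr_eq0 => /eqP d00.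
    have := modulus_of_real (k := k) d; rewrite d00 modulus0 gtr0_norm// => dd.
    by move: d0; rewrite -dd ltxx.
  by rewrite mulr0 subr0.
Qed.

(** Unimodular factors do not change [M], so the bound depends on neither [f] nor [A] and is uniform
    in m. *)
Lemma sign_sum_le (f : X) (n : nat) (A : set nat) : A `<=` `I_n ->
  M (\sum_(i \in A) sign (xs i f) *: x i) <= \sum_(i \in `I_n) M (x i).
Proof.
move=> An; have fA := sub_finite_set An (finite_II n).
apply: (le_trans (p_norm_power_fsum p0 hM _ _ fA)).
rewrite (fsbigID A `I_n)//= (setIidr An) ler_wpDr//.
  by apply: fsumr_ge0 => i _; exact: (p_norm_power_ge0 hM).
by apply: ler_fsumr => // i _; rewrite (p_norm_powerZ hM) modulus_sign powR1 mul1r.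
Qed.

Lemma restricted_truncation_small (f : X) (e : R) : 0 < e ->
  exists m0, forall m, (m0 <= m)%N -> N (restricted_truncation x xs m f) < e.
Proof.
(* Halved because [N ^ p] is at most [2 * M]. Half of [e'] goes to the bound for [g], half to the
   terms below [n]. *)
move=> e0; pose e' := e `^ p / 2.
have e'0 : 0 < e' by rewrite divr_gt0// powR_gt0.
have M0 := p_norm_power_ge0 hM.
suff [m0 hm] : exists m0, forall m, (m0 <= m)%N -> M (restricted_truncation x xs m f) < e'.
  exists m0 => m /hm h; apply: (powR_ltr_cancel p) => //; first exact: (quasi_norm_ge0 hN).
    exact: ltW.
  by apply: le_lt_trans (NM _) _; rewrite -ltr_pdivlMl// mulrC.
have L1 : 0 < L + 1 by rewrite ltr_wpDl.
have [g [n [Mg gf g0]]] := small_remainder f (e' / 2 / (L + 1))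
  (divr_gt0 (divr_gt0 e'0 (ltr0n R 2)) L1).
have LMg : L * M g < e' / 2.
  move: Mg; rewrite ltr_pdivlMr// mulrC; apply: le_lt_trans.
  by rewrite ler_wpM2r// lerDl.
have [eta eta0 heta] := finite_lower_bound (fun j => modulus (xs j g)) n g0.
set T := \sum_(i \in `I_n) M (x i).
have T0 : 0 <= T by apply: fsumr_ge0 => i _; exact: M0.
have [d d0 dT] := small_powR_mul (2 * T) (e' / 2)
  (mulr_ge0 (ler0n R 2) T0) (divr_gt0 e'0 (ltr0n R 2)).
(* A threshold below [d] makes the correction terms small; one below [eta] lets the coefficients of
   [g] below [n] dominate it. *)
have de0 : 0 < Num.min d eta by rewrite lt_min d0.
have [m0 hm0] := inf_mth_greedy_set_small f (Num.min d eta) de0.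
exists m0 => m mm0; rewrite /restricted_truncation.
have [->|] := mth_greedy_set_cases (xs := xs) f m.
  rewrite /restricted_truncation_set fsbig_set0 scaler0.
  by case: ifP; rewrite (p_norm_power0 p0 hM).
set A := mth_greedy_set xs f m => mA.
have [fA gA] := is_mth_greedy_set_greedy f m A mA.
rewrite /restricted_truncation_set; case: asboolP => // _.
set s := inf _.
have s0 : 0 <= s by exact: inf_moduli_ge0.
have sA i : A i -> s <= modulus (xs i f) by exact: inf_moduli_le.
have [i Ai] := hm0 m A mm0 mA; rewrite le_min => /andP[id ieta].
have sd : s <= d := le_trans (sA i Ai) id.
have seta : s <= eta := le_trans (sA i Ai) ieta.
(* The index [i] shows that [A] is nonempty, so [s] is a genuine infimum and inherits the greedy
   lower bounds. *)
have nAs j : ~ A j -> modulus (xs j f) <= s.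
  move=> nAj; apply: lb_le_inf; first by exists (modulus (xs i f)); exists i.
  by move=> _ [l Al <-]; exact: gA.
pose B := A `|` `I_n.
have fB : finite_set B by rewrite finite_setU.
have sB j : B j -> s <= modulus (xs j g).
  have [jn _|nj [/sA|/=]] := ltnP j n; first exact: le_trans seta (heta j jn).
    by rewrite gf.
  by rewrite ltnNge nj.
have gB : greedy_set xs g B.
  move=> l j /sB sl nBj; apply: le_trans sl.
  have nj : (n <= j)%N by rewrite leqNgt; apply/negP => jn; apply: nBj; right.
  by rewrite gf//; apply: nAs => Aj; apply: nBj; left.
(* From [n] on, [A] and [B] have the same indices and [f] and [g] the same coefficients, so only
   terms below [n] have to be corrected. *)
have sumE : \sum_(j \in A) sign (xs j f) *: x j =
    \sum_(j \in B) sign (xs j g) *: x j +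
    (\sum_(j \in A `&` `I_n) sign (xs j f) *: x j - \sum_(j \in `I_n) sign (xs j g) *: x j).
  rewrite (fsbigID `I_n A)//= (fsbigID `I_n B)//=.
  have -> : B `&` `I_n = `I_n by rewrite setIUl setIid; apply: setUidr => j [].
  have -> : B `&` ~` `I_n = A `&` ~` `I_n by rewrite setIUl setICr setU0.
  rewrite [RHS]addrC addrA subrK; congr (_ + _).
  by apply: eq_fsbigr => j; rewrite inE => -[_ /= /negP]; rewrite -leqNgt => nj; rewrite gf.
rewrite sumE scalerDr; apply: le_lt_trans (p_norm_powerD hM _ _) _.
have h1 := hL g B s fB gB s0 sB.
suff h2 : M (of_real k s *: (\sum_(j \in A `&` `I_n) sign (xs j f) *: x j -
    \sum_(j \in `I_n) sign (xs j g) *: x j)) <= d `^ p * (2 * T) by lra.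
rewrite (p_norm_powerZr hM)// ler_pM ?powR_ge0//.
  by apply: ge0_ler_powR; rewrite ?nnegrE// ltW.
apply: le_trans (p_norm_powerD hM _ _) _; rewrite (p_norm_powerN hM).
have a1 := sign_sum_le f n (A `&` `I_n) (@subIsetr _ _ _).
have a2 := sign_sum_le g n `I_n (@subset_refl _ _).
by rewrite -/T in a1 a2; lra.
Qed.

End Vanishing.

(** * The explicit constant *)

Section LambdaBound.
Context {R : realType} {k : scalar_kind}
  {X : PreUniformLmodule.type (scalar_field R k)}.
Context {N : X -> R} {x : nat -> X} {xs : nat -> {scalar X}}.
Context (hN : quasi_norm N) (hB : quasi_greedy_basis N x xs).
Context {p : R} (p0 : 0 < p) (pD : forall f g, N (f + g) `^ p <= N f `^ p + N g `^ p).

Let C := C_qg N x xs.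

Lemma p_norm_power_powR : p_norm_power p (fun f => N f `^ p).
Proof.
split=> //; first by move=> f; exact: powR_ge0.
by move=> a f; rewrite (quasi_normZ hN) powRM ?modulus_ge0 ?(quasi_norm_ge0 hN).
Qed.

(** This is [truncation_bound] for [M] = [N ^ p] and D = C^p, followed by a p-th root; using [N ^ p]
    directly avoids the factor 2 of Aoki-Rolewicz. *)
Lemma truncation_bound_eta (f : X) (A : set nat) (s t : R) : 0 < t < 1 ->
    finite_set A -> greedy_set xs f A -> 0 <= s ->
    (forall n, A n -> s <= modulus (xs n f)) ->
  N (of_real k s *: \sum_(n \in A) sign (xs n f) *: x n) <=
    (1 - t `^ p) `^ (- p^-1) *
    (1 - (1 + (A_const p)^-1 * C^-1 * t) `^ (- p)) `^ (- p^-1) * (C * N f).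
Proof.
move=> /andP[t0 t1] fA gA s0 sP; have [C1 hC] := C_qg_spec hN hB.
rewrite -/C in C1 hC; have C0 : 0 < C := lt_le_trans ltr01 C1.
have N0 := quasi_norm_ge0 hN.
have bio : forall n j, xs n (x j) = (j == n)%:R by case: hB => -[].
have D0 : 0 <= C `^ p by exact: powR_ge0.
have hD g A' B : finite_set A' -> greedy_set xs g A' -> greedy_set xs g B -> B `<=` A' ->
    N (proj_set x xs (A' `\` B) g) `^ p <= C `^ p * N g `^ p.
  move=> fA' gA' gB BA; rewrite -powRM// ?(ltW C0)//.
  by apply: ge0_ler_powR; rewrite ?nnegrE ?mulr_ge0 ?(ltW C0) ?(ltW p0)// hC.
have lt_powR (a b : R) : 0 <= a -> a < b -> a `^ p < b `^ p.
  by move=> a0 ab; apply: gt0_ltr_powR; rewrite ?nnegrE// (le_trans a0)// ltW.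
have one_p : 1 `^ p = 1 :> R by rewrite powR1.
have two_p : 0 < 2 `^ p - 1 :> R.
  by have := lt_powR 1 2 ler01; rewrite one_p subr_gt0 ltr1n; apply.
pose a : R := A_const p; have a0 : 0 < a by exact: powR_gt0.
have ap : a^-1 `^ p = 2 `^ p - 1.
  by rewrite /a /A_const -powRN opprK powR_invK// ltW.
(* Since a^-p = 2^p - 1, this makes the absorbed fraction equal to t^p. *)
pose d := a^-1 * C^-1 * t.
have d0 : 0 < d by rewrite !mulr_gt0 ?invr_gt0.
have qE : d `^ p * (C `^ p / (2 `^ p - 1)) = t `^ p.
  have CC : C^-1 `^ p * C `^ p = 1.
    by rewrite -powRM ?invr_ge0 ?(ltW C0)// mulVf ?one_p// gt_eqF.
  rewrite /d !powRM ?mulr_ge0 ?invr_ge0 ?(ltW C0) ?(ltW a0) ?(ltW t0)// ap.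
  rewrite -[RHS]mul1r -[X in _ = X * _]CC; field; by rewrite gt_eqF.
have q1 : d `^ p * (C `^ p / (2 `^ p - 1)) < 1.
  by rewrite qE -[ltRHS]one_p lt_powR// ltW.
have := truncation_bound _ _ bio p0 p_norm_power_powR D0 hD d0 q1 f A s fA gA s0 sP.
rewrite qE => h.
apply: (powR_ler_cancel p) => //.
  by rewrite !mulr_ge0 ?powR_ge0 ?(ltW C0).
apply: (le_trans h); rewrite !powRM ?mulr_ge0 ?powR_ge0 ?(ltW C0)//.
have root (u : R) : 0 <= u -> (u `^ (- p^-1)) `^ p = u^-1.
  by move=> u0; rewrite -powRrM mulNr mulVf ?gt_eqF// powR_inv1.
rewrite !root.
- by rewrite -/d [X in _ <= X * _]mulrC mulrA.
- rewrite subr_ge0 powRN invf_le1 ?powR_gt0 ?ltr_wpDl ?(ltW d0)//.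
  by rewrite -[leLHS]one_p ltW// lt_powR// ltrDl.
- by rewrite subr_ge0 -qE ltW.
Qed.

Lemma Lambda_u_le : (Lambda_u N x xs <= (C ^+ 2 * eta_fun p C)%:E)%E.
Proof.
have [C1 _] := C_qg_spec hN hB; rewrite -/C in C1.
have C0 : 0 < C := lt_le_trans ltr01 C1.
apply: ge_ereal_sup => _ [f [A [gA f1 ->]]]; rewrite lee_fin.
(* Dividing by C^2 isolates the infimum over [t], so that it suffices to prove the bound for each
   [t]. *)
rewrite mulrC -ler_pdivrMr ?exprn_gt0//; apply: lb_le_inf.
  by apply: image_nonempty; exists 2^-1; rewrite /= in_itv/= invr_gt0 ltr0n invf_lt1 ?ltr1n.
move=> y [t /=]; rewrite in_itv/= => t01 <-; rewrite ler_pdivrMr ?exprn_gt0//.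
set E := (X in _ <= X * _).
have E0 : 0 <= E by rewrite mulr_ge0 ?powR_ge0.
apply: (restricted_truncation_set_ind (fun g => N g <= E * C ^+ 2)) => //.
  by rewrite -(scale0r (0 : X)) (quasi_normZ hN) modulus0 mul0r mulr_ge0 ?exprn_ge0 ?(ltW C0).
move=> s fA s0 sP; apply: le_trans (truncation_bound_eta f A s t t01 fA gA s0 sP) _.
(* The second factor C comes from N(f) <= 1 <= C. *)
rewrite ler_wpM2l// expr2 ler_wpM2l ?(ltW C0)//; exact: le_trans f1 C1.
Qed.

End LambdaBound.

Theorem theorem3p13 (R : realType) (k : scalar_kind)
    (X : PreUniformLmodule.type (scalar_field R k)) (N : X -> R)
    (x : nat -> X) (xs : nat -> {scalar X})
    (hX : quasi_banach N) (hB : quasi_greedy_basis N x xs) :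
  (uniformly_bounded N (restricted_truncation x xs) /\
   forall p : R, 0 < p -> p <= 1 -> p_banach N p ->
     (Lambda_u N x xs <= (C_qg N x xs ^+ 2 * eta_fun p (C_qg N x xs))%:E)%E) /\
  forall f : X, restricted_truncation x xs m f @[m --> \oo] --> (0 : X).
Proof.
have hN := quasi_banach_norm hX.
split; first split.
- have [p [M [L [[p0 L0] hM MN NM hL]]]] := exists_truncation_bound hN hB.
  (* On the unit ball [M] of the truncation is at most [L], hence its [N ^ p] is at most 2 L. *)
  apply: (@le_lt_trans _ _ ((2 * L) `^ p^-1)%:E); last exact: ltry.
  apply: ge_ereal_sup => _ [m _ <-]; apply: ge_ereal_sup => _ [f /= f1 <-].
  rewrite lee_fin; apply: (powR_ler_cancel p) => //; first exact: (quasi_norm_ge0 hN).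
    exact: powR_ge0.
  rewrite powR_invK ?mulr_ge0//; apply: le_trans (NM _) _; rewrite ler_wpM2l//.
  apply: (restricted_truncation_set_ind (fun g => M g <= L)).
  + by rewrite (p_norm_power0 p0 hM).
  + exact: mth_greedy_set_greedy.
  + move=> s fA s0 sP; apply: (le_trans (hL f _ s fA _ s0 sP)).
      exact: mth_greedy_set_greedy.
    rewrite ler_piMr//; apply: (le_trans (MN f)).
    have := @ge0_ler_powR _ p (ltW p0) (N f) 1; rewrite powR1; apply=> //; rewrite nnegrE//.
    exact: (quasi_norm_ge0 hN).
- by move=> p p0 _ [_ pD]; exact: Lambda_u_le.
- move=> f; have [p [M [L [[p0 L0] hM MN NM hL]]]] := exists_truncation_bound hN hB.
  apply/cvg_entourageP => E; rewrite (quasi_banach_entourage hX) => -[e /= e0 eE].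
  have [m0 hm0] := restricted_truncation_small hX hB p0 L0 hM MN NM hL f e e0.
  exists m0 => // m /= /hm0 h; apply: eE => /=.
  by rewrite sub0r -scaleN1r (quasi_normZ hN) modulusN1 mul1r.
Qed.
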